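(* Suppose that the dimension of $M_1$ is higher than one and that $g_1$ has negative sectional curvature. Suppose that for every $r>k_1$, every $x\in M_1$, every two-dimensional subspace $\sigma\subseteq T_xM_1$ and every $e\in\sigma$ with $g_1(e,e)=1$, $$(\nabla dk)(e,e)<\frac{1+4rk}{2k(1+rk)}\,e(k)^2+\frac{1}{4k(1+rk)}\,\Vert dk\Vert_1^2-k(1+rk)\,K(\sigma),$$ where $k$ and $dk$ are evaluated at $x$. Then $G_r$ has negative sectional curvature for any $r\in(k_1,+\infty)$.
   Context: $(M_1,g_1)$ is a connected, complete Riemannian manifold, and $k:M_1\to\mathbb R$ is a $C^\infty$ function with $k_0:=\inf_{x\in M_1}k(x)>0$. If $k$ is bounded, put $K_0:=\sup_{x\in M_1}k(x)$ and $k_1:=-K_0^{-1}$; if $k$ is unbounded from above, put $k_1:=0$. For $r>k_1$, $G_r:=(\frac1k+r)g_1$ is a Riemannian metric on $M_1$. $\nabla$ is the Levi-Civita connection of $g_1$, $\nabla dk$ the Hessian of $k$, $K(\sigma)$ the sectional curvature of $g_1$ on the plane $\sigma$, $\Vert\cdot\Vert_1$ the norm determined by $g_1$, and $e(k)=dk(e)$. *)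

(* Defs.v *)
From HB Require Import structures.
Set Warnings "-notation-overridden,-notation-incompatible-prefix,-ambiguous-paths".
From mathcomp Require Import all_boot all_order all_algebra.
From mathcomp Require Import all_classical all_reals all_analysis.

Set Implicit Arguments.
Unset Strict Implicit.
Unset Printing Implicit Defensive.

Import Order.TTheory GRing.Theory Num.Theory.
Import numFieldNormedType.Exports.

Local Open Scope classical_set_scope.
Local Open Scope ring_scope.

Section Smooth.
Context {R : realType} {n : nat}.
Implicit Types (U : set 'rV[R]_n) (f : 'rV[R]_n -> R).

Definition partial (i : 'I_n) f (p : 'rV[R]_n) : R := 'D_(delta_mx 0 i) f p.

(* [Ck_on m U f] and [smooth_on U f] are meant for [U] open *)
Fixpoint Ck_on (m : nat) U f : Prop :=
  {in U, continuous f} /\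
  if m is m'.+1 then
    forall i, {in U, forall p, derivable f p (delta_mx 0 i)} /\
              Ck_on m' U (partial i f)
  else True.

Definition smooth_on U f : Prop := forall m, Ck_on m U f.

End Smooth.

(* [param] is only relevant on [coord @` dom], where it is inverse to [coord] *)
Record chart (R : realType) (n : nat) (M : topologicalType) := Chart {
  dom : set M ;
  coord :> M -> 'rV[R]_n ;
  param : 'rV[R]_n -> M ;
  dom_open : open dom ;
  image_open : open (coord @` dom) ;
  coordK : {in dom, cancel coord param} ;
  coord_continuous : {in dom, continuous coord} ;
  param_continuous : {in coord @` dom, continuous param} }.

(* An [n]-dimensional manifold without boundary. The atlas need not be maximal.
   The preferred chart [chart_at x] identifies the tangent space at [x] with
   ['rV[R]_n]: the row vector [v] stands for the sum of the [v 0 i] times the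
   [i]-th coordinate vector field of [chart_at x] at [x]. *)
Record smooth_manifold (R : realType) (n : nat) := SmoothManifold {
  carrier :> topologicalType ;
  manifold_hausdorff : hausdorff_space carrier ;
  manifold_second_countable : @second_countable carrier ;
  atlas : set (chart R n carrier) ;
  chart_at : carrier -> chart R n carrier ;
  chart_at_atlas : forall x, atlas (chart_at x) ;
  chart_at_dom : forall x, dom (chart_at x) x ;
  atlas_smooth : forall c d, atlas c -> atlas d -> forall j : 'I_n,
    smooth_on (c @` (dom c `&` dom d)) (fun p => d (param c p) 0 j) }.

Section Riemannian.
Context {R : realType} {n : nat} {M : smooth_manifold R n}.

Definition smooth_function (k : M -> R) : Prop :=
  forall c, atlas c -> smooth_on (c @` dom c) (k \o param c).

(* A field of bilinear forms on the tangent spaces, given at each [x] by its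
   Gram matrix in the basis induced by [chart_at x]. *)
Definition form_field := M -> 'M[R]_n.
Implicit Types (g : form_field) (k : M -> R) (x : M) (u v w z : 'rV[R]_n).

Definition form_at g x u v : R := (u *m g x *m v^T) 0 0.

(* Gram matrix of [g] in the coordinate fields of the chart [c], at the point
   with coordinates [p] in [c]. *)
Definition local_form g (c : chart R n M) (p : 'rV[R]_n) : 'M[R]_n :=
  let y := param c p in
  let J := jacobian (fun q => chart_at y (param c q)) p in
  J *m g y *m J^T.

Definition riemannian_metric g : Prop :=
  [/\ forall x u v, form_at g x u v = form_at g x v u,
      forall x v, v != 0 -> 0 < form_at g x v v
    & forall c, atlas c -> forall i j,
        smooth_on (c @` dom c) (fun p => local_form g c p i j)].

(* [christoffel g c l i j] is the [l]-th component of the Levi-Civita covariant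
   derivative of the [j]-th coordinate field along the [i]-th one. *)
Definition christoffel g (c : chart R n M) (l i j : 'I_n) (p : 'rV[R]_n) : R :=
  let h := local_form g c in
  2^-1 * \sum_(m < n) invmx (h p) l m *
    (partial i (fun q => h q m j) p + partial j (fun q => h q m i) p
     - partial m (fun q => h q i j) p).

(* [riemann g c l i j q] is the [l]-th component of [R(d_i, d_j) d_q], for
   [R(X, Y) Z = D_X (D_Y Z) - D_Y (D_X Z) - D_[X, Y] Z]. *)
Definition riemann g (c : chart R n M) (l i j q : 'I_n) (p : 'rV[R]_n) : R :=
  partial i (christoffel g c l j q) p - partial j (christoffel g c l i q) p
  + \sum_(m < n) (christoffel g c m j q p * christoffel g c l i m p
                  - christoffel g c m i q p * christoffel g c l j m p).

Definition curvature_vector g x u v w : 'rV[R]_n :=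
  \row_l \sum_(i < n) \sum_(j < n) \sum_(q < n)
    u 0 i * v 0 j * w 0 q * riemann g (chart_at x) l i j q (chart_at x x).

Definition sectional_curvature_of g x u v : R :=
  form_at g x (curvature_vector g x u v v) u /
  (form_at g x u u * form_at g x v v - form_at g x u v ^+ 2).

(* For a plane [s]; the value does not depend on the basis of [s]. *)
Definition sectional_curvature g x (s : {vspace 'rV[R]_n}) : R :=
  sectional_curvature_of g x (vbasis s)`_0 (vbasis s)`_1.

Definition negative_sectional_curvature g : Prop :=
  forall x (s : {vspace 'rV[R]_n}), (\dim s = 2)%N ->
    sectional_curvature g x s < 0.

Definition geodesic g (gamma : R -> M) : Prop :=
  continuous gamma /\
  forall c, atlas c -> forall t, dom c (gamma t) ->
    let a : R -> 'rV[R]_n := c \o gamma in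
    [/\ derivable a t 1, derivable (derive1 a) t 1
      & forall l, derive1 (derive1 a) t 0 l
          + \sum_(i < n) \sum_(j < n)
              christoffel g c l i j (a t) * derive1 a t 0 i * derive1 a t 0 j
          = 0].

(* geodesic completeness; equivalent to metric completeness by Hopf-Rinow *)
Definition complete_metric g : Prop :=
  forall x v, exists gamma : R -> M,
    [/\ geodesic g gamma, gamma 0 = x
      & derive1 (chart_at x \o gamma : R -> 'rV[R]_n) 0 = v].

Definition differential k x v : R :=
  'D_v (k \o param (chart_at x)) (chart_at x x).

Definition sqnorm_differential g k x : R :=
  let D := \row_i differential k x (delta_mx 0 i) in
  (D *m invmx (g x) *m D^T) 0 0.

Definition hessian g k x u v : R :=
  let c := chart_at x in
  let f := k \o param c in
  \sum_(i < n) \sum_(j < n) u 0 i * v 0 j *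
    (partial i (partial j f) (c x)
     - \sum_(l < n) christoffel g c l i j (c x) * partial l f (c x)).

Definition lower_bound_r k : R :=
  if `[< has_ubound (range k) >] then - (sup (range k))^-1 else 0.

Definition rescaled_metric g k (r : R) : form_field :=
  fun x => ((k x)^-1 + r) *: g x.

End Riemannian.

Arguments form_field {R n} M.

(* Main.v *)
Require Import Defs.
From HB Require Import structures.
From mathcomp Require Import all_boot all_order all_algebra.
From mathcomp Require Import all_classical all_reals all_analysis.
From mathcomp Require Import ring lra.
Import Order.TTheory GRing.Theory Num.Theory.
Import numFieldNormedType.Exports.
Local Open Scope classical_set_scope.
Local Open Scope ring_scope.

(** The metrics [G_r] and [g_1] are conformal, [G_r = phi g_1] with
    [phi = 1/k + r > 0], so the curvature of [G_r] at a point is that of [g_1]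
    corrected by first and second derivatives of [phi] at this point. Write
    [E], [F], [G] for the [g_1]-products of the vectors [u], [v] of a basis of
    a plane, [N] and [N'] for the numerators of the sectional curvatures of
    [g_1] and [G_r] on it, and [H] for the covariant Hessian of [phi]. Then
    ([curvature_conformal])
<<
      N' = phi N - (H(u,u) G + H(v,v) E - 2 H(u,v) F) / 2
           + 3 (phi_u^2 G + phi_v^2 E - 2 phi_u phi_v F) / (4 phi)
           - |d phi|^2 (E G - F^2) / (4 phi).
>>
    For [phi = 1/k + r] one has [d phi = - dk / k^2] and
    [H = - Hess k / k^2 + 2 dk dk / k^3]. The first two expressions in
    parentheses are [E G - F^2] times the traces over the plane of [H] and of
    [d phi d phi]. Adding the assumed inequality for the two vectors of an
    orthonormal basis of the plane bounds the trace of [Hess k] ([plane_trace_lt]), and after substitution this bound says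
    exactly that [N' < 0] ([conformal_curvature_lt0]).

    The transformation law is proved in the chart at the given point. The field
    [connection h u v] is the covariant derivative of the constant field [v]
    along the constant field [u]; it is determined by the Koszul formula
    ([form_connection]). Lowering the index of the curvature vector with the
    metric removes all derivatives of the inverse matrix and leaves derivatives
    of Koszul expressions and products of connection fields
    ([form_curvature]). Both behave simply under [h |-> phi h]: a Koszul
    expression is multiplied by [phi] and shifted by terms linear in [d phi].

    The calculus is that of functions that are twice differentiable at one
    point. This class contains the smooth functions
    ([smooth_twice_differentiable]), is closed under the operations that occur,
    and has symmetric second derivatives ([schwarz]). *)

Set Implicit Arguments.
Unset Strict Implicit.
Unset Printing Implicit Defensive.

(** * Differentiability and mean values *)

(** Differentiability in terms of epsilons, in which it is seen to be a local
    property. *)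
Lemma diff_le_normP (R : numFieldType) (V W : normedModType R) (f : V -> W)
    (df : {linear V -> W}) (x : V) : continuous df ->
  (f \o shift x = cst (f x) + df +o_ 0 id) <->
  (forall e, 0 < e ->
     \forall y \near x, `|f y - f x - df (y - x)| <= e * `|y - x|).
Proof.
move=> df_cont.
have E y : (f \o shift x - (cst (f x) + df)) (y + (0 - x))
         = f y - f x - df (y - x).
  by rewrite -[LHS]/(f (y + (0 - x) + x) - (f x + df (y + (0 - x))))
    sub0r addrNK opprD addrA.
split=> [fE e e0|fE].
  have /eqaddoP/(_ _ e0) := fE; rewrite !near_simpl (near_shift x 0).
  by apply: filterS => y; rewrite /comp /shift E sub0r.
apply/eqaddoP => e e0; rewrite !near_simpl (near_shift x 0).
by apply: filterS (fE e e0) => y; rewrite /comp /shift E sub0r.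
Qed.

Lemma differentiable_le_norm (R : numFieldType) (V W : normedModType R)
    (f : V -> W) (df : {linear V -> W}) (x : V) : continuous df ->
  (forall e, 0 < e ->
     \forall y \near x, `|f y - f x - df (y - x)| <= e * `|y - x|) ->
  differentiable f x /\ 'd f x = df :> (V -> W).
Proof.
move=> dfc /(diff_le_normP _ _ dfc) fE; have dE := diff_unique dfc fE.
by split=> //; apply/diff_locallyP; rewrite dE.
Qed.

Lemma diff_le_norm (R : numFieldType) (V W : normedModType R)
    (f : V -> W) (x : V) (e : R) : differentiable f x -> 0 < e ->
  \forall y \near x, `|f y - f x - 'd f x (y - x)| <= e * `|y - x|.
Proof.
move=> df; have [dfc fE] := (diff_locallyP x f).1 df.
exact: (diff_le_normP f x dfc).1 fE e.
Qed.

Lemma near_eq_diff (R : numFieldType) (V W : normedModType R)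
    (f g : V -> W) (x : V) : {near x, f =1 g} -> differentiable f x ->
  differentiable g x /\ 'd g x = 'd f x :> (V -> W).
Proof.
move=> fg df; apply: differentiable_le_norm => [|e e0].
  exact: diff_continuous.
have fgx := nbhs_singleton fg.
near=> y; rewrite -fgx -(near fg y) //; near: y.
exact: diff_le_norm.
Unshelve. all: by end_near. Qed.

Lemma is_derive_line (R : numFieldType) (V W : normedModType R) (f : V -> W)
    (q v : V) (s : R) (d : W) :
  is_derive (q + s *: v) v f d -> is_derive s 1 (fun t => f (q + t *: v)) d.
Proof.
have E : (fun h : R => h^-1 *: (((fun t => f (q + t *: v)) \o shift s) (h *: 1)
             - f (q + s *: v)))
        = (fun h => h^-1 *: ((f \o shift (q + s *: v)) (h *: v)
             - f (q + s *: v))).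
  apply/funext => h /=; congr (_ *: (f _ - _)).
  by rewrite [h *: 1]mulr1 scalerDl addrCA.
by case=> df <-; split; rewrite /derivable /derive E.
Qed.

Lemma mean_value_segment (R : realType) (V : normedModType R) (f : V -> R)
    (q v : V) :
  (forall s : R, 0 <= s <= 1 -> derivable f (q + s *: v) v) ->
  exists2 s : R, 0 <= s <= 1 & f (q + v) - f q = 'D_v f (q + s *: v).
Proof.
move=> fdrv; pose g (t : R) := f (q + t *: v).
have gdrv (s : R) : 0 <= s <= 1 -> is_derive s 1 g ('D_v f (q + s *: v)).
  by move=> /fdrv sd; apply: is_derive_line; exact/derivableP.
have [||s sI] := @MVT_segment R g (fun t => 'D_v f (q + t *: v)) 0 1 ler01.
- move=> x /itvP xI; apply: gdrv; rewrite !ltW ?xI //.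
- apply: derivable_within_continuous => x; rewrite in_itv /= => /gdrv xd.
  exact: ex_derive.
rewrite /g scale1r scale0r addr0 subr0 mulr1 => ->.
by exists s; rewrite // (itvP sI).
Qed.

Lemma is_derive_scale (R : numFieldType) (V W : normedModType R) (f : V -> W)
    (p v : V) (a : R) : derivable f p v ->
  is_derive p (a *: v) f (a *: 'D_v f p).
Proof.
move=> fd; pose g (h : R) := f (p + h *: v).
have gd : is_derive (0 : R) 1 g ('D_v f p).
  by apply: is_derive_line; rewrite scale0r addr0; exact/derivableP.
have gdiff : differentiable g 0 by apply/derivable1_diffP.
have fdE : 'D_v f p = 'd g 0 1.
  rewrite -deriveE; first by rewrite (@derive_val _ _ _ _ _ _ _ gd).
  exact: gdiff.
have gdiffM : differentiable g (a * 0) by rewrite mulr0.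
have gaE : (fun h : R => f (p + h *: (a *: v))) = g \o *%R a.
  by apply/funext => h /=; rewrite /g scalerA mulrC.
have mdiff : is_diff 0 ( *%R a : R -> R) ( *%R a).
  exact: is_diff_scaler.
have gadiff : differentiable (g \o *%R a) 0.
  exact: differentiable_comp.
have gaD : 'D_1 (g \o *%R a) 0 = a *: 'D_v f p.
  rewrite deriveE // diff_comp //= diff_val mulr0 fdE /=.
  by rewrite -[a * 1]/(a *: (1 : R)) linearZ.
have E : (fun h : R => h^-1 *: ((f \o shift p) (h *: (a *: v)) - f p))
  = (fun h : R => h^-1 *: ((g \o *%R a \o shift 0) (h *: 1) - (g \o *%R a) 0)).
  apply/funext => h; rewrite -gaE /= scale0r !addr0 [h *: 1]mulr1.
  by rewrite [_ + p]addrC.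
split; last by rewrite -gaD /derive E.
by rewrite /derivable E; exact: diff_derivable.
Qed.

(** Going from [p] to [y] along the coordinate axes one after the other, the
    mean value theorem turns each partial increment into a value of a partial
    derivative at a point close to [p], where it differs little from its value
    at [p]. *)
Lemma continuous_partials_differentiable (R : realType) (n : nat)
    (U : set 'rV[R]_n) (f : 'rV[R]_n -> R) (p : 'rV[R]_n) :
  open U -> Ck_on 1 U f -> U p -> differentiable f p.
Proof.
move=> U_open [_ f1] Up.
have fd i q : U q -> derivable f q (delta_mx 0 i).
  by move=> Uq; case: (f1 i) => + _; apply; rewrite inE.
have fc i : {for p, continuous (partial i f)}.
  by case: (f1 i) => _ [+ _]; apply; rewrite inE.
pose d (v : 'rV[R]_n) := \sum_i v 0 i * partial i f p.
have d_lin : linear d.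
  move=> a v w; rewrite /d scaler_sumr -big_split /=; apply: eq_bigr => i _.
  by rewrite !mxE mulrDl -scalerAl.
pose dL := GRing.isLinear.Build _ _ _ _ _ d_lin.
pose df : {linear 'rV[R]_n -> R} := HB.pack d dL.
have [] // := @differentiable_le_norm _ _ _ f df p.
  have -> : (df : _ -> _) = \sum_i (fun v => v 0 i * partial i f p).
    by apply/funext => v; rewrite fct_sumE.
  elim/big_ind : _ => [|g h gc hc|i _] v; first exact: cst_continuous.
    by apply: continuousD; [exact: gc|exact: hc].
  apply: (@continuousM _ _ (fun w : 'rV[R]_n => w 0 i) (cst _)).
    exact: coord_continuous.
  exact: cst_continuous.
move=> e e0.
(* The [n] coordinates share the error [e]; the summand [1] keeps [N] positive
   when [n = 0]. *)
pose N : R := n%:R + 1.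
have N0 : 0 < N by rewrite ltr_wpDl.
have eN0 : 0 < e / N by rewrite divr_gt0.
have e1 (i : 'I_n) (a : R) : `|a *: delta_mx 0 i : 'rV[R]_n| <= `|a|.
  rewrite normrZ; apply: ler_piMr => //.
  rewrite [leLHS]/Num.Def.normr /= mx_normrE; apply/bigmax_leP; split => // k _.
  by rewrite mxE; case: (_ && _); rewrite ?normr1 ?normr0 ?ler01.
have le_coord (v : 'rV[R]_n) (i : 'I_n) : `|v 0 i| <= `|v|.
  rewrite [leRHS]/Num.Def.normr /= mx_normrE.
  by rewrite (le_bigmax _ (fun ij : 'I_1 * 'I_n => `|v ij.1 ij.2|) (0, i)).
pose part (s : seq 'I_n) (v : 'rV[R]_n) :=
  \sum_(i <- s) v 0 i *: (delta_mx 0 i : 'rV[R]_n).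
have part_le s v : `|part s v| <= (size s)%:R * `|v|.
  rewrite /part; elim: s => [|i s IHs]; first by rewrite big_nil normr0 mul0r.
  rewrite big_cons /= -[(size s).+1]add1n natrD mulrDl mul1r.
  by rewrite (le_trans (ler_normD _ _)) // lerD // (le_trans (e1 _ _)).
(* Induction on the list of the coordinates that have already been changed. *)
have incr (s : seq 'I_n) : \forall v \near (0 : 'rV[R]_n),
    `|f (p + part s v) - f p - \sum_(i <- s) v 0 i * partial i f p|
    <= (size s)%:R * (e / N * `|v|).
  elim: s => [|i s IHs].
    by near=> v; rewrite /part !big_nil addr0 subr0 subrr normr0 mul0r.
  have /nbhs_normP[/= r r0 rP] : \forall q \near p,
      U q /\ `|partial i f q - partial i f p| <= e / N.
    apply: filterI; first exact: open_nbhs_nbhs.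
    have /cvgrPdist_le/(_ _ eN0) := fc i.
    by apply: filterS => q; rewrite distrC.
  have sr0 : 0 < r / ((size s).+1)%:R by rewrite divr_gt0.
  near=> v; rewrite /part !big_cons -/(part s v).
  have inU (t : R) : 0 <= t <= 1 ->
     U (p + part s v + t *: (v 0 i *: delta_mx 0 i)) /\
     `|partial i f (p + part s v + t *: (v 0 i *: delta_mx 0 i))
       - partial i f p| <= e / N.
    move=> /andP[t0 t1]; apply: rP.
    rewrite /ball_ /= -addrA opprD addNKr normrN.
    apply: (@le_lt_trans _ _ ((size s).+1%:R * `|v|)).
      rewrite -[(size s).+1]add1n natrD mulrDl mul1r addrC.
      rewrite (le_trans (ler_normD _ _)) // lerD // normrZ ger0_norm //.
      by rewrite (le_trans (ler_piMl _ t1)) // (le_trans (e1 _ _)).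
    by rewrite mulrC -ltr_pdivlMr //.
  have [|t t01] :=
      @mean_value_segment _ _ f (p + part s v) (v 0 i *: delta_mx 0 i).
    by move=> t /inU[Ut _]; apply: ex_derive; apply: is_derive_scale; exact: fd.
  have [Ut tle] := inU t t01.
  have /@derive_val -> := is_derive_scale (v 0 i) (fd i _ Ut).
  rewrite -/(partial i f _) => mv.
  rewrite [v 0 i *: _ + _]addrC addrA.
  have -> : f (p + part s v + v 0 i *: delta_mx 0 i) - f p -
      (v 0 i * partial i f p + \sum_(j <- s) v 0 j * partial j f p)
    = v 0 i * (partial i f (p + part s v + t *: (v 0 i *: delta_mx 0 i))
               - partial i f p)
     + (f (p + part s v) - f p - \sum_(j <- s) v 0 j * partial j f p).
    rewrite mulrBr -[v 0 i * _ in RHS]mv; ring.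
  rewrite /= -[(size s).+1]add1n natrD mulrDl mul1r.
  rewrite (le_trans (ler_normD _ _)) // lerD //.
    by rewrite normrM [leRHS]mulrC ler_pM.
  by near: v.
near=> y.
have -> : f y = f (p + part (index_enum 'I_n) (y - p)).
  by rewrite /part -row_sum_delta addrC subrK.
rewrite -[df (y - p)]/(d (y - p)) /d.
apply: (@le_trans _ _ ((size (index_enum 'I_n))%:R * (e / N * `|y - p|))).
  near: y; have := incr (index_enum 'I_n); rewrite (near_shift p 0).
  by apply: filterS => v /=; rewrite sub0r.
have -> : (size (index_enum 'I_n))%:R = n%:R :> R.
  by rewrite -[index_enum _]enumT size_enum_ord.
rewrite mulrA ler_wpM2r // mulrCA; apply: ler_piMr; first exact: ltW.
by rewrite ler_pdivrMr // mul1r ler_wpDr.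
Unshelve. all: by end_near. Qed.

(** * Functions that are twice differentiable at a point *)

Section TwiceDifferentiable.
Context {R : realType} {V : normedModType R}.
Implicit Types (f g : V -> R) (p q v w : V).

Definition twice_differentiable f p : Prop :=
  (\forall q \near p, differentiable f q) /\
  forall v, differentiable ('D_v f) p.

Lemma twice_differentiableW f p : twice_differentiable f p -> differentiable f p.
Proof. by case=> /nbhs_singleton. Qed.

Lemma deriveDv f p v w : differentiable f p ->
  'D_(v + w) f p = 'D_v f p + 'D_w f p.
Proof. by move=> fd; rewrite !deriveE // linearD. Qed.

Lemma deriveZv f p a v : differentiable f p -> 'D_(a *: v) f p = a * 'D_v f p.
Proof. by move=> fd; rewrite !deriveE // linearZ. Qed.

Lemma is_derive_translate f p a v (d : R) :
  is_derive (p + a) v f d -> is_derive p v (fun q => f (q + a)) d.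
Proof.
have E : (fun h : R => h^-1 *: (((fun q => f (q + a)) \o shift p) (h *: v)
             - f (p + a)))
        = (fun h : R => h^-1 *: ((f \o shift (p + a)) (h *: v) - f (p + a))).
  by apply/funext => h /=; rewrite addrA.
by case=> df <-; split; rewrite /derivable /derive E.
Qed.

(** The mean value theorem is applied once, to [q |-> f (q + h w) - f q] along
    [v], and gives [h] times an increment of [D_v f] close to [p]; the
    differentiability of [D_v f] at [p] evaluates this increment. *)
Lemma second_difference_derive f p v w (e : R) :
  twice_differentiable f p -> 0 < e ->
  \forall h \near (0 : R)^'+,
    `|f (p + h *: v + h *: w) - f (p + h *: v) - f (p + h *: w) + f p
      - h ^+ 2 * 'D_w ('D_v f) p| <= e * h ^+ 2 * (2 * `|v| + `|w|).
Proof.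
move=> [f_near f2] e0; pose F := 'D_v f.
have Fd : differentiable F p := f2 v.
have /nbhs_normP[/= r r0 rP] : \forall q \near p, differentiable f q /\
    `|F q - F p - 'd F p (q - p)| <= e * `|q - p|.
  by apply: filterI => //; exact: diff_le_norm.
pose C := `|v| + `|w| + 1.
have C0 : 0 < C by rewrite ltr_wpDl // addr_ge0.
have rC0 : 0 < r / C by rewrite divr_gt0.
near=> h.
have h0 : 0 < h by near: h; exact: nbhs_right_gt.
have hr : h < r / C by near: h; exact: nbhs_right_lt.
have inball (s t : R) : 0 <= s <= 1 -> 0 <= t <= 1 ->
    `|p - (p + s *: (h *: v) + t *: (h *: w))| < r.
  move=> /andP[s0 s1] /andP[t0 t1]; rewrite -addrA opprD addNKr normrN.
  apply: (@le_lt_trans _ _ (h * `|v| + h * `|w|)).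
    rewrite (le_trans (ler_normD _ _)) // !normrZ (gtr0_norm h0) !ger0_norm //.
    by rewrite lerD // ler_piMl // mulr_ge0 // ltW.
  rewrite -mulrDr (@le_lt_trans _ _ (h * C)) //; last by rewrite -ltr_pdivlMr.
  by rewrite ler_wpM2l ?ltW // /C ltrDl.
have Fball (s t : R) : 0 <= s <= 1 -> 0 <= t <= 1 ->
    let y := s *: (h *: v) + t *: (h *: w) in
    differentiable f (p + y) /\ `|F (p + y) - F p - 'd F p y| <= e * `|y|.
  move=> s01 t01 y; have := rP _ (inball s t s01 t01).
  by rewrite -addrA -/y (_ : p + y - p = y) // addrC addKr.
have lex11 : 0 <= (1 : R) <= 1 by rewrite ler01 lexx.
have lex01 : 0 <= (0 : R) <= 1 by rewrite ler01 lexx.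
pose g q := f (q + h *: w) - f q.
have gd (s : R) : 0 <= s <= 1 ->
    is_derive (p + s *: (h *: v)) (h *: v) g
      (h * (F (p + s *: (h *: v) + h *: w) - F (p + s *: (h *: v)))).
  move=> s01; rewrite mulrBr; apply: is_deriveB.
    have [+ _] := Fball s 1 s01 lex11; rewrite scale1r addrA => fd.
    by apply: is_derive_translate; exact: is_derive_scale (diff_derivable fd).
  have [+ _] := Fball s 0 s01 lex01; rewrite scale0r addr0 => fd.
  exact: is_derive_scale (diff_derivable fd).
have [|s s01] := @mean_value_segment _ _ g p (h *: v).
  by move=> s /gd sd; apply: ex_derive.
rewrite (@derive_val _ _ _ _ _ _ _ (gd s s01)) {1 2}/g => gE.
have -> : f (p + h *: v + h *: w) - f (p + h *: v) - f (p + h *: w) + f p =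
    h * (F (p + s *: (h *: v) + h *: w) - F (p + s *: (h *: v))).
  rewrite -gE; ring.
have dZ a x : 'd F p (a *: x) = a * 'd F p x by rewrite linearZ.
have [_] := Fball s 1 s01 lex11; have [_] := Fball s 0 s01 lex01.
rewrite scale1r scale0r addr0 linearD !dZ addrA [in 'D_w _ _]deriveE //.
set L1 := 'd F p v; set L2 := 'd F p w => F1e F2e.
set F1 := F _ in F1e *; set F2 := F _ in F2e *.
have -> : h * (F2 - F1) - h ^+ 2 * L2 =
    h * ((F2 - F p - (s * (h * L1) + h * L2)) - (F1 - F p - s * (h * L1))).
  ring.
rewrite normrM gtr0_norm //.
rewrite [leRHS](_ : _ = h * (e * (h * (2 * `|v| + `|w|)))); last by ring.
rewrite ler_pM2l // (le_trans (ler_normB _ _)) // (le_trans (lerD F2e F1e)) //.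
rewrite -mulrDr ler_pM2l // (le_trans (lerD (ler_normD _ _) (lexx _))) //.
rewrite !normrZ (gtr0_norm h0); have /andP[s0 s1] := s01; rewrite (ger0_norm s0).
have : s * (h * `|v|) <= h * `|v| by rewrite ler_piMl // mulr_ge0 // ltW.
by lra.
Unshelve. all: by end_near. Qed.

(** The second difference is symmetric in [v] and [w] and, divided by
    [h ^+ 2], tends to both iterated derivatives. *)
Lemma schwarz f p v w : twice_differentiable f p ->
  'D_v ('D_w f) p = 'D_w ('D_v f) p.
Proof.
move=> f2; apply/eqP; rewrite -subr_eq0 -normr_le0.
apply/ler_addgt0Pl => e e0; rewrite addr0.
pose K := 3 * `|v| + 3 * `|w| + 1.
have K0 : 0 < K by rewrite ltr_wpDl // addr_ge0 // mulr_ge0.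
have eK0 : 0 < e / K by rewrite divr_gt0.
near (0 : R)^'+ => h.
have h0 : 0 < h by near: h; exact: nbhs_right_gt.
have h20 : 0 < h ^+ 2 by rewrite exprn_gt0.
have vw : `|f (p + h *: v + h *: w) - f (p + h *: v) - f (p + h *: w) + f p
      - h ^+ 2 * 'D_w ('D_v f) p| <= e / K * h ^+ 2 * (2 * `|v| + `|w|).
  by near: h; exact: second_difference_derive.
have wv : `|f (p + h *: w + h *: v) - f (p + h *: w) - f (p + h *: v) + f p
      - h ^+ 2 * 'D_v ('D_w f) p| <= e / K * h ^+ 2 * (2 * `|w| + `|v|).
  by near: h; exact: second_difference_derive.
rewrite -(ler_pM2l h20).
have -> : h ^+ 2 * `|'D_v ('D_w f) p - 'D_w ('D_v f) p| =
    `|h ^+ 2 * ('D_v ('D_w f) p - 'D_w ('D_v f) p)|.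
  by rewrite normrM gtr0_norm.
move: vw wv; rewrite -[p + h *: w + h *: v]addrA [h *: w + _]addrC addrA.
set A := f _; set B := f _; set C := f _; set D := f p.
set X := 'D_w _ _; set Y := 'D_v _ _ => vw wv.
have -> : h ^+ 2 * (Y - X) =
   (A - B - C + D - h ^+ 2 * X) - (A - C - B + D - h ^+ 2 * Y) by ring.
rewrite (le_trans (ler_normB _ _)) // (le_trans (lerD vw wv)) //.
have eKh : 0 < e / K * h ^+ 2 by rewrite mulr_gt0.
rewrite [leRHS](_ : _ = e / K * h ^+ 2 * K).
  rewrite -mulrDr ler_pM2l // /K.
  by rewrite [leLHS](_ : _ = 3 * `|v| + 3 * `|w|) ?lerDl //; ring.
by field; rewrite gt_eqF.
Unshelve. all: by end_near. Qed.

Lemma twice_differentiable_cst (c : R) p : twice_differentiable (cst c) p.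
Proof.
split; first by near=> q; exact: differentiable_cst.
move=> v; have -> : 'D_v (cst c) = cst (0 : R) :> (V -> R).
  by apply/funext => q; rewrite derive_cst.
exact: differentiable_cst.
Unshelve. all: by end_near. Qed.

Lemma twice_differentiableD f g p :
  twice_differentiable f p -> twice_differentiable g p ->
  twice_differentiable (f + g) p.
Proof.
move=> [f1 f2] [g1 g2]; split.
  by apply: filterS2 f1 g1 => q; exact: differentiableD.
move=> v.
apply: (proj1 (@near_eq_diff _ _ _ ('D_v f + 'D_v g) ('D_v (f + g)) p _ _)).
  apply: filterS2 f1 g1 => q fq gq.
  by rewrite deriveD //; exact: diff_derivable.
exact: differentiableD.
Qed.

Lemma twice_differentiableM f g p :
  twice_differentiable f p -> twice_differentiable g p ->
  twice_differentiable (f * g) p.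
Proof.
move=> fp gp; have [f1 f2] := fp; have [g1 g2] := gp; split.
  by apply: filterS2 f1 g1 => q; exact: differentiableM.
move=> v; apply: (proj1
    (@near_eq_diff _ _ _ (f * 'D_v g + g * 'D_v f) ('D_v (f * g)) p _ _)).
  apply: filterS2 f1 g1 => q fq gq.
  by rewrite deriveM //; exact: diff_derivable.
apply: differentiableD; apply: differentiableM => //;
  exact: twice_differentiableW.
Qed.

Lemma near_neq0 f p : differentiable f p -> f p != 0 ->
  \forall q \near p, f q != 0.
Proof.
by move=> fd fp0; exact: cvgr_neq0 (differentiable_continuous fd) fp0.
Qed.

Lemma twice_differentiableV f p :
  twice_differentiable f p -> f p != 0 ->
  twice_differentiable (fun q => (f q)^-1) p.
Proof.
move=> fp fp0; have [f1 f2] := fp; have fd := twice_differentiableW fp.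
have fn0 := near_neq0 fd fp0.
split.
  by apply: filterS2 f1 fn0 => q; exact: differentiableV.
move=> v; have [] // := @near_eq_diff _ _ _
    (fun q => - (((f q)^-1) * ((f q)^-1) * 'D_v f q)) ('D_v (fun q => (f q)^-1)) p.
  apply: filterS2 f1 fn0 => q fq fq0.
  rewrite deriveV //; last exact: diff_derivable.
  by rewrite -[RHS]/(- (f q) ^- 2 * 'D_v f q) mulNr expr2 invfM.
apply: differentiableN; apply: differentiableM => //.
by apply: differentiableM; exact: differentiableV.
Qed.

End TwiceDifferentiable.

(** * Finite sums, inverse matrices and smooth functions *)

Section FiniteSums.
Context {R : realType} {V : normedModType R}.
Implicit Types (f g : V -> R) (p v : V).

Lemma differentiable_fun_sum (I : finType) (F : I -> V -> R) p :
  (forall i, differentiable (F i) p) ->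
  differentiable (fun q => \sum_i F i q) p.
Proof.
move=> Fd; have -> : (fun q => \sum_i F i q) = \sum_i F i.
  by apply/funext => q; rewrite fct_sumE.
elim/big_ind : _ => [|f g|i _]; [exact: differentiable_cst| |exact: Fd].
exact: differentiableD.
Qed.

Lemma differentiable_fun_prod (I : finType) (F : I -> V -> R) p :
  (forall i, differentiable (F i) p) ->
  differentiable (fun q => \prod_i F i q) p.
Proof.
move=> Fd; have -> : (fun q => \prod_i F i q) = \prod_i F i.
  by apply/funext => q; rewrite fct_prodE.
elim/big_ind : _ => [|f g|i _]; [exact: differentiable_cst| |exact: Fd].
exact: differentiableM.
Qed.

Lemma derive_fun_sum (I : finType) (F : I -> V -> R) p v :
  (forall i, differentiable (F i) p) ->
  'D_v (fun q => \sum_i F i q) p = \sum_i 'D_v (F i) p.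
Proof.
move=> Fd; have -> : (fun q => \sum_i F i q) = \sum_i F i.
  by apply/funext => q; rewrite fct_sumE.
suff [] : differentiable (\sum_i F i) p /\
  'D_v (\sum_i F i) p = \sum_i 'D_v (F i) p by [].
elim/big_ind2 : _ => [|f df g dg [f1 <-] [g1 <-]|i _]; last by [].
  by split; [exact: differentiable_cst|rewrite derive_cst].
by split; [exact: differentiableD|rewrite deriveD //; exact: diff_derivable].
Qed.

Lemma twice_differentiable_sum (I : finType) (F : I -> V -> R) p :
  (forall i, twice_differentiable (F i) p) ->
  twice_differentiable (fun q => \sum_i F i q) p.
Proof.
move=> Fd; have -> : (fun q => \sum_i F i q) = \sum_i F i.
  by apply/funext => q; rewrite fct_sumE.
elim/big_ind : _ => [|f g|i _]; last exact: Fd.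
  exact: twice_differentiable_cst.
exact: twice_differentiableD.
Qed.

Lemma derive_mul f g p v : differentiable f p -> differentiable g p ->
  'D_v (fun q => f q * g q) p = f p * 'D_v g p + g p * 'D_v f p.
Proof. by move=> fd gd; apply: deriveM; exact: diff_derivable. Qed.

Lemma derive_mulc f (c : R) p v : differentiable f p ->
  'D_v (fun q => c * f q) p = c * 'D_v f p.
Proof.
move=> fd; rewrite (derive_mul v (differentiable_cst c p) fd) derive_cst.
by rewrite mulr0 addr0.
Qed.

Lemma differentiable_mulc f (c : R) p : differentiable f p ->
  differentiable (fun q => c * f q) p.
Proof. by move=> fd; apply: (differentiableM (differentiable_cst c p) fd). Qed.

Lemma differentiable_det n (A : V -> 'M[R]_n) p :
  (forall i j, differentiable (fun q => A q i j) p) ->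
  differentiable (fun q => \det (A q)) p.
Proof.
move=> Ad; apply: differentiable_fun_sum => s; apply: differentiable_mulc.
apply: differentiable_fun_prod => i; exact: Ad.
Qed.

Lemma near_unitmx n (A : V -> 'M[R]_n) p :
  (forall i j, differentiable (fun q => A q i j) p) -> A p \in unitmx ->
  \forall q \near p, A q \in unitmx.
Proof.
move=> Ad; rewrite unitmxE unitfE => /(near_neq0 (differentiable_det Ad)).
by apply: filterS => q; rewrite unitmxE unitfE.
Qed.

Lemma differentiable_invmx n (A : V -> 'M[R]_n) p i j :
  (forall i j, differentiable (fun q => A q i j) p) -> A p \in unitmx ->
  differentiable (fun q => invmx (A q) i j) p.
Proof.
move=> Ad Au.
pose B q := (\det (A q))^-1 * cofactor (A q) j i.
have [] // := @near_eq_diff _ _ _ B (fun q => invmx (A q) i j) p.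
  by apply: filterS (near_unitmx Ad Au) => q qu; rewrite /invmx qu !mxE.
apply: differentiableM.
  apply: differentiableV; first exact: differentiable_det.
  by rewrite -unitfE -unitmxE.
rewrite /cofactor; apply: differentiable_mulc.
apply: differentiable_det => k l; under eq_fun do rewrite !mxE.
exact: Ad.
Qed.

End FiniteSums.

Section Coordinates.
Context {R : realType} {n : nat}.
Implicit Types (f : 'rV[R]_n -> R) (p v : 'rV[R]_n) (U : set 'rV[R]_n).

Lemma derive_partial f p v : differentiable f p ->
  'D_v f p = \sum_i v 0 i * partial i f p.
Proof.
move=> fd; rewrite [in LHS](row_sum_delta v) deriveE // linear_sum /=.
by apply: eq_bigr => i _; rewrite linearZ /= -deriveE.
Qed.

Lemma smooth_twice_differentiable U f p :
  open U -> smooth_on U f -> U p -> twice_differentiable f p.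
Proof.
move=> U_open fU Up; have [fc f2] := fU 2.
have f1 : Ck_on 1 U f.
  by split=> // i; have [fd [fdc _]] := f2 i.
have fd q : U q -> differentiable f q.
  exact: continuous_partials_differentiable.
have Unear : \forall q \near p, U q by exact: open_nbhs_nbhs.
split; first exact: filterS Unear.
move=> v; have [] // := @near_eq_diff _ _ _
    (fun q => \sum_i v 0 i * partial i f q) ('D_v f) p.
  by apply: filterS Unear => q /fd/derive_partial ->.
apply: differentiable_fun_sum => i; apply: differentiable_mulc.
by have [_] := f2 i; move/continuous_partials_differentiable; apply.
Qed.

End Coordinates.

(** * Levi-Civita connection and curvature in coordinates *)

Section LocalMetric.
Context {R : realType} {n : nat}.
Implicit Types (h : 'rV[R]_n -> 'M[R]_n) (p q u v w x y z : 'rV[R]_n).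

Definition form h q x y : R := (x *m h q *m y^T) 0 0.

(** [christoffel] and [riemann] depend on a metric only through its Gram matrices
    in the chart. They are restated for any field of matrices [h], to be applied
    to [local_form g c] and to its multiple by a function. *)
Definition christoffel_of h (l i j : 'I_n) q : R :=
  2^-1 * \sum_(m < n) invmx (h q) l m *
    (partial i (fun q => h q m j) q + partial j (fun q => h q m i) q
     - partial m (fun q => h q i j) q).

Definition riemann_of h (l i j k : 'I_n) q : R :=
  partial i (christoffel_of h l j k) q - partial j (christoffel_of h l i k) q
  + \sum_(m < n) (christoffel_of h m j k q * christoffel_of h l i m q
                  - christoffel_of h m i k q * christoffel_of h l j m q).

(** The covariant derivative of the constant field [v] along the constant
    field [u]. *)
Definition connection h u v q : 'rV[R]_n :=
  \row_l \sum_i \sum_j u 0 i * v 0 j * christoffel_of h l i j q.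

Definition curvature_of h u v w q : 'rV[R]_n :=
  \row_l \sum_(i < n) \sum_(j < n) \sum_(k < n)
    u 0 i * v 0 j * w 0 k * riemann_of h l i j k q.

Definition koszul h u v z q : R :=
  2^-1 * ('D_u (fun q => form h q v z) q + 'D_v (fun q => form h q u z) q
          - 'D_z (fun q => form h q u v) q).

Lemma connectionE h u v q l : connection h u v q 0 l =
  \sum_i \sum_j u 0 i * v 0 j * christoffel_of h l i j q.
Proof. by rewrite mxE. Qed.

Lemma formE h q x y : form h q x y = \sum_i \sum_j x 0 i * y 0 j * h q i j.
Proof.
rewrite /form mxE exchange_big /=; apply: eq_bigr => j _.
rewrite !mxE mulr_suml; apply: eq_bigr => i _; ring.
Qed.

Lemma formDl h q x y z : form h q (x + y) z = form h q x z + form h q y z.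
Proof. by rewrite /form !mulmxDl mxE. Qed.

Lemma formZl h q a x z : form h q (a *: x) z = a * form h q x z.
Proof. by rewrite /form -!scalemxAl mxE. Qed.

Lemma formNl h q x z : form h q (- x) z = - form h q x z.
Proof. by rewrite -scaleN1r formZl mulN1r. Qed.

Lemma formDr h q x y z : form h q z (x + y) = form h q z x + form h q z y.
Proof. by rewrite /form linearD mulmxDr mxE. Qed.

Lemma formZr h q a x z : form h q z (a *: x) = a * form h q z x.
Proof. by rewrite /form linearZ -scalemxAr mxE. Qed.

Lemma formNr h q x z : form h q z (- x) = - form h q z x.
Proof. by rewrite -scaleN1r formZr mulN1r. Qed.

Section AtPoint.
Variables (h : 'rV[R]_n -> 'M[R]_n) (p : 'rV[R]_n).
Hypothesis h_sym : forall q, (h q)^T = h q.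

Lemma h_symE q i j : h q i j = h q j i.
Proof. by rewrite -[in LHS]h_sym mxE. Qed.

Lemma formC q x y : form h q x y = form h q y x.
Proof.
rewrite /form -[in LHS](trmxK (x *m h q *m y^T)) mxE.
by rewrite !trmx_mul trmxK h_sym mulmxA.
Qed.

Lemma koszulC u v z q : koszul h u v z q = koszul h v u z q.
Proof.
rewrite /koszul.
have -> : (fun q => form h q u v) = (fun q => form h q v u).
  by apply/funext => r; rewrite formC.
ring.
Qed.

(** The connection is compatible with the metric. *)
Lemma derive_form_koszul u x z q :
  'D_u (fun q => form h q x z) q = koszul h u x z q + koszul h u z x q.
Proof.
rewrite /koszul.
have -> : (fun q => form h q z x) = (fun q => form h q x z).
  by apply/funext => r; rewrite formC.
have -> : (fun q => form h q u z) = (fun q => form h q z u).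
  by apply/funext => r; rewrite formC.
have -> : (fun q => form h q u x) = (fun q => form h q x u).
  by apply/funext => r; rewrite formC.
by field.
Qed.

Section Derivatives.
Variable q : 'rV[R]_n.
Hypothesis hd : forall i j, differentiable (fun q => h q i j) q.

Lemma differentiable_form x y : differentiable (fun q => form h q x y) q.
Proof.
under eq_fun do rewrite formE.
apply: differentiable_fun_sum => i; apply: differentiable_fun_sum => j.
exact: differentiable_mulc.
Qed.

Lemma derive_form u x y :
  'D_u (fun q => form h q x y) q =
  \sum_i \sum_j x 0 i * y 0 j * 'D_u (fun q => h q i j) q.
Proof.
under eq_fun do rewrite formE.
rewrite derive_fun_sum => [|i]; last first.
  by apply: differentiable_fun_sum => j; exact: differentiable_mulc.
apply: eq_bigr => i _; rewrite derive_fun_sum => [|j]; last first.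
  exact: differentiable_mulc.
by apply: eq_bigr => j _; rewrite derive_mulc.
Qed.

Lemma derive_form_partial u x y :
  'D_u (fun q => form h q x y) q =
  \sum_m \sum_i \sum_j u 0 m * x 0 i * y 0 j * partial m (fun q => h q i j) q.
Proof.
rewrite derive_form exchange_big /=; under [RHS]eq_bigr do rewrite exchange_big /=.
rewrite [RHS]exchange_big /=; apply: eq_bigr => j _.
rewrite [RHS]exchange_big /=; apply: eq_bigr => i _.
rewrite derive_partial // mulr_sumr; apply: eq_bigr => m _; ring.
Qed.

(** The bracket terms of the Koszul formula vanish for constant fields; what is
    left is a contraction of the Christoffel symbols of the first kind. *)
Lemma koszul_partial u v z :
  koszul h u v z q = \sum_m z 0 m * \sum_i \sum_j u 0 i * v 0 j * (2^-1 *
    (partial i (fun q => h q m j) q + partial j (fun q => h q m i) q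
     - partial m (fun q => h q i j) q)).
Proof.
rewrite /koszul !derive_form_partial.
have sw i j : (fun q => h q i j) = (fun q => h q j i).
  by apply/funext => r; rewrite h_symE.
have -> : \sum_m \sum_i \sum_j u 0 m * v 0 i * z 0 j * partial m (fun q => h q i j) q
  = \sum_m \sum_i \sum_j z 0 m * u 0 i * v 0 j * partial i (fun q => h q m j) q.
  rewrite exchange_big /=; under eq_bigr do rewrite exchange_big /=.
  rewrite exchange_big /=; apply: eq_bigr => m _.
  rewrite exchange_big /=; apply: eq_bigr => i _.
  by apply: eq_bigr => j _; rewrite sw; ring.
have -> : \sum_m \sum_i \sum_j v 0 m * u 0 i * z 0 j * partial m (fun q => h q i j) q
  = \sum_m \sum_i \sum_j z 0 m * u 0 i * v 0 j * partial j (fun q => h q m i) q.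
  under eq_bigr do rewrite exchange_big /=.
  rewrite exchange_big /=; apply: eq_bigr => m _.
  rewrite exchange_big /=; apply: eq_bigr => i _.
  by apply: eq_bigr => j _; rewrite sw; ring.
rewrite -big_split -sumrB /= mulr_sumr; apply: eq_bigr => m _.
rewrite -big_split -sumrB /= !mulr_sumr; apply: eq_bigr => i _.
rewrite -big_split -sumrB /= !mulr_sumr; apply: eq_bigr => j _.
ring.
Qed.

Lemma connection_lowered u v : h q \in unitmx ->
  connection h u v q *m h q = \row_m \sum_i \sum_j u 0 i * v 0 j * (2^-1 *
    (partial i (fun q => h q m j) q + partial j (fun q => h q m i) q
     - partial m (fun q => h q i j) q)).
Proof.
move=> hu; set K := \row_m _.
suff -> : connection h u v q = K *m invmx (h q) by rewrite mulmxKV.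
apply/rowP => l; rewrite !mxE.
under [RHS]eq_bigr do rewrite mxE mulr_suml.
rewrite [RHS]exchange_big /=; apply: eq_bigr => i _.
under [RHS]eq_bigr do rewrite mulr_suml.
rewrite [RHS]exchange_big /=; apply: eq_bigr => j _.
rewrite /christoffel_of !mulr_sumr; apply: eq_bigr => m _.
have -> : invmx (h q) l m = invmx (h q) m l.
  by rewrite -[in LHS](trmxK (invmx (h q))) mxE trmx_inv h_sym.
ring.
Qed.

(** The Koszul formula. It replaces the components of the connection, which
    contain an inverse matrix, by derivatives of the metric. *)
Lemma form_connection u v z : h q \in unitmx ->
  form h q (connection h u v q) z = koszul h u v z q.
Proof.
move=> hu; rewrite /form connection_lowered // koszul_partial mxE.
by apply: eq_bigr => m _; rewrite !mxE mulrC.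
Qed.

End Derivatives.

Hypothesis h2 : forall i j, twice_differentiable (fun q => h q i j) p.
Hypothesis h_unit : h p \in unitmx.

Let hd i j : differentiable (fun q => h q i j) p.
Proof. exact: twice_differentiableW. Qed.

Lemma near_differentiable_unit : \forall q \near p,
  (forall i j, differentiable (fun q => h q i j) q) /\ h q \in unitmx.
Proof.
have near_d : \forall q \near p, forall i j, differentiable (fun q => h q i j) q.
  apply: (@filter_forall _ _
    (fun i q => forall j, differentiable (fun q => h q i j) q) _ (nbhs_filter p)) => i.
  apply: (@filter_forall _ _
    (fun j q => differentiable (fun q => h q i j) q) _ (nbhs_filter p)) => j.
  by have [] := h2 i j.
by apply: filterS2 near_d (near_unitmx hd h_unit) => q.
Qed.

Lemma twice_differentiable_form x y :
  twice_differentiable (fun q => form h q x y) p.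
Proof.
under eq_fun do rewrite formE.
apply: twice_differentiable_sum => i; apply: twice_differentiable_sum => j.
apply: twice_differentiableM => //; exact: twice_differentiable_cst.
Qed.

Lemma near_form_connection u v z : \forall q \near p,
  form h q (connection h u v q) z = koszul h u v z q.
Proof.
by apply: filterS near_differentiable_unit => q [qd qu]; exact: form_connection.
Qed.

Lemma differentiable_koszul u v z : differentiable (koszul h u v z) p.
Proof.
have fd x y w : differentiable ('D_w (fun q => form h q x y)) p.
  by have [_] := twice_differentiable_form x y.
apply: differentiable_mulc; apply: differentiableB => //.
exact: differentiableD.
Qed.

Lemma differentiable_christoffel l i j : differentiable (christoffel_of h l i j) p.
Proof.
have fd a b c : differentiable (partial c (fun q => h q a b)) p.
  by have [_ hab] := h2 a b; exact: hab.
apply: differentiable_mulc; apply: differentiable_fun_sum => m.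
apply: differentiableM; first exact: differentiable_invmx.
by apply: differentiableB => //; exact: differentiableD.
Qed.

Lemma differentiable_connection u v l :
  differentiable (fun q => connection h u v q 0 l) p.
Proof.
under eq_fun do rewrite connectionE.
apply: differentiable_fun_sum => i; apply: differentiable_fun_sum => j.
apply: differentiable_mulc; exact: differentiable_christoffel.
Qed.

Lemma derive_connection u v w l :
  'D_w (fun q => connection h u v q 0 l) p =
  \sum_i \sum_j u 0 i * v 0 j * 'D_w (christoffel_of h l i j) p.
Proof.
have cd := differentiable_christoffel.
under eq_fun do rewrite connectionE.
rewrite derive_fun_sum => [|i]; last first.
  by apply: differentiable_fun_sum => j; exact: differentiable_mulc.
apply: eq_bigr => i _; rewrite derive_fun_sum => [|j]; last first.
  exact: differentiable_mulc.
by apply: eq_bigr => j _; rewrite derive_mulc.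
Qed.

(** The usual [D_u D_v w - D_v D_u w] for constant fields, whose brackets
    vanish; it follows by expanding both sides in components. *)
Lemma curvature_ofE u v w :
  curvature_of h u v w p =
    \row_l 'D_u (fun q => connection h v w q 0 l) p
    - \row_l 'D_v (fun q => connection h u w q 0 l) p
    + (connection h u (connection h v w p) p
       - connection h v (connection h u w p) p).
Proof.
have cd := differentiable_christoffel.
have subE (a b c d : 'rV[R]_n) l :
    (a - b + (c - d)) 0 l = a 0 l - b 0 l + (c 0 l - d 0 l) by rewrite !mxE.
have rowE (F : 'I_n -> R) l : (\row_i F i) 0 l = F l by rewrite mxE.
have congr4 (a b c d a' b' c' d' : R) :
    a = a' -> b = b' -> c = c' -> d = d' ->
    a - b + (c - d) = a' - b' + (c' - d') by move=> -> -> -> ->.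
apply/rowP => l; rewrite subE; apply/esym.
have Eu : (\row_l 'D_u (fun q => connection h v w q 0 l) p) 0 l =
  \sum_i \sum_j \sum_k u 0 i * v 0 j * w 0 k * partial i (christoffel_of h l j k) p.
  rewrite rowE derive_connection.
  rewrite [RHS]exchange_big /=; apply: eq_bigr => j _.
  rewrite [RHS]exchange_big /=; apply: eq_bigr => k _.
  rewrite derive_partial // mulr_sumr; apply: eq_bigr => i _; ring.
have Ev : (\row_l 'D_v (fun q => connection h u w q 0 l) p) 0 l =
  \sum_i \sum_j \sum_k u 0 i * v 0 j * w 0 k * partial j (christoffel_of h l i k) p.
  rewrite rowE derive_connection.
  apply: eq_bigr => i _; rewrite [RHS]exchange_big /=; apply: eq_bigr => k _.
  rewrite derive_partial // mulr_sumr; apply: eq_bigr => j _; ring.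
have Euv : connection h u (connection h v w p) p 0 l =
  \sum_i \sum_j \sum_k u 0 i * v 0 j * w 0 k *
     \sum_m christoffel_of h m j k p * christoffel_of h l i m p.
  rewrite connectionE; apply: eq_bigr => i _.
  under eq_bigr do rewrite connectionE mulr_sumr mulr_suml.
  rewrite exchange_big /=; apply: eq_bigr => j _.
  under eq_bigr do rewrite mulr_sumr mulr_suml.
  rewrite exchange_big /=; apply: eq_bigr => k _.
  rewrite mulr_sumr; apply: eq_bigr => m _; ring.
have Evu : connection h v (connection h u w p) p 0 l =
  \sum_i \sum_j \sum_k u 0 i * v 0 j * w 0 k *
     \sum_m christoffel_of h m i k p * christoffel_of h l j m p.
  rewrite connectionE [RHS]exchange_big /=; apply: eq_bigr => j _.
  under eq_bigr do rewrite connectionE mulr_sumr mulr_suml.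
  rewrite exchange_big /=; apply: eq_bigr => i _.
  under eq_bigr do rewrite mulr_sumr mulr_suml.
  rewrite exchange_big /=; apply: eq_bigr => k _.
  rewrite mulr_sumr; apply: eq_bigr => m _; ring.
apply: etrans (congr4 _ _ _ _ _ _ _ _ Eu Ev Euv Evu) _.
rewrite rowE -!sumrB -big_split /=; apply: eq_bigr => i _.
rewrite -!sumrB -big_split /=; apply: eq_bigr => j _.
rewrite -!sumrB -big_split /=; apply: eq_bigr => k _.
rewrite /riemann_of sumrB.
by rewrite -mulrBr -mulrBr -mulrDr.
Qed.

(** Differentiate the Koszul formula for [connection h v w] along [u]; the
    derivative of the metric is expressed by metric compatibility. *)
Lemma form_derive_connection u v w z :
  form h p (\row_l 'D_u (fun q => connection h v w q 0 l) p) z =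
  'D_u (koszul h v w z) p - koszul h u (connection h v w p) z p
    - koszul h u z (connection h v w p) p.
Proof.
apply/eqP; rewrite -addrA -opprD -derive_form_koszul eq_sym subr_eq; apply/eqP.
rewrite -(near_eq_derive _ (near_form_connection v w z)).
have Cd := differentiable_connection v w.
have rowE (F : 'I_n -> R) l : (\row_i F i) 0 l = F l by rewrite mxE.
under eq_fun do rewrite formE.
rewrite derive_fun_sum => [|i]; last first.
  apply: differentiable_fun_sum => j; apply: differentiableM => //.
  by apply: differentiableM => //; exact: differentiable_cst.
rewrite derive_form // formE -big_split /=; apply: eq_bigr => i _.
rewrite derive_fun_sum => [|j]; last first.
  apply: differentiableM => //.
  by apply: differentiableM => //; exact: differentiable_cst.
rewrite -big_split /=; apply: eq_bigr => j _.
have dz : differentiable (fun _ : 'rV[R]_n => z 0 j) p.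
  exact: differentiable_cst.
have dCz : differentiable (fun q => connection h v w q 0 i * z 0 j) p.
  exact: differentiableM.
rewrite (derive_mul u dCz (hd i j)) (derive_mul u (Cd i) dz) derive_cst rowE.
rewrite mulr0 add0r; ring.
Qed.

(** Lowering the index of the curvature vector cancels the two terms of the form
    [connection h u (connection h v w)]: no derivative of an inverse matrix and
    no iterated connection is left. *)
Lemma form_curvature u v w z :
  form h p (curvature_of h u v w p) z =
    'D_u (koszul h v w z) p - 'D_v (koszul h u w z) p
    - form h p (connection h v w p) (connection h u z p)
    + form h p (connection h u w p) (connection h v z p).
Proof.
have E (a b c d : 'rV[R]_n) : form h p (a - b + (c - d)) z =
    form h p a z - form h p b z + (form h p c z - form h p d z).
  by rewrite !(formDl, formNl).
have F x a c d : form h p (connection h x a p) (connection h c d p) =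
    koszul h c d (connection h x a p) p.
  by rewrite formC form_connection.
rewrite curvature_ofE E; rewrite (form_derive_connection u v w z).
rewrite (form_derive_connection v u w z).
rewrite (form_connection hd u (connection h v w p) z h_unit).
rewrite (form_connection hd v (connection h u w p) z h_unit).
rewrite (F v w u z) (F u w v z).
set A := koszul _ _ _ _ _; set B := koszul _ _ _ _ _.
set C := koszul _ _ _ _ _; set D := koszul _ _ _ _ _.
set X := 'D_u _ _; set Y := 'D_v _ _.
by move: X Y A B C D => X Y A B C D; ring.
Qed.

End AtPoint.
End LocalMetric.

(** * Conformal change of the metric *)

Section Conformal.
Context {R : realType} {n : nat}.
Variables (h : 'rV[R]_n -> 'M[R]_n) (phi : 'rV[R]_n -> R) (p : 'rV[R]_n).
Implicit Types (q u v w x y z : 'rV[R]_n).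
Hypothesis h_sym : forall q, (h q)^T = h q.
Hypothesis h2 : forall i j, twice_differentiable (fun q => h q i j) p.
Hypothesis h_unit : h p \in unitmx.
Hypothesis phi2 : twice_differentiable phi p.
Hypothesis phi_neq0 : phi p != 0.

Definition conformal q : 'M[R]_n := phi q *: h q.

Definition gradient : 'rV[R]_n := (\row_i partial i phi p) *m invmx (h p).

(** [\nabla d phi], as the second derivative along constant fields minus the
    derivative along their covariant derivative. *)
Definition covariant_hessian u v : R :=
  'D_u ('D_v phi) p - 'D_(connection h u v p) phi p.

Let phid : differentiable phi p := twice_differentiableW phi2.

Let hd i j : differentiable (fun q => h q i j) p.
Proof. exact: twice_differentiableW. Qed.

Let phi2d u : differentiable ('D_u phi) p.
Proof. by have [_] := phi2. Qed.

Lemma form_inj x y : (forall z, form h p x z = form h p y z) -> x = y.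
Proof.
move=> xy; rewrite -(mulmxK h_unit x) -(mulmxK h_unit y); congr (_ *m _).
apply/rowP => j; have := xy (delta_mx 0 j).
by rewrite /form trmx_delta -!colE !mxE.
Qed.

Lemma form_gradient z : form h p gradient z = 'D_z phi p.
Proof.
rewrite /form /gradient mulmxKV // derive_partial // mxE.
by apply: eq_bigr => i _; rewrite !mxE mulrC.
Qed.

Lemma conformal_sym q : (conformal q)^T = conformal q.
Proof. by rewrite /conformal linearZ /= h_sym. Qed.

Lemma conformal_twice_differentiable i j :
  twice_differentiable (fun q => conformal q i j) p.
Proof.
by under eq_fun do rewrite mxE; exact: twice_differentiableM.
Qed.

Lemma conformal_unit : conformal p \in unitmx.
Proof. by rewrite unitmxZ // unitfE. Qed.

Lemma form_conformal q x y : form conformal q x y = phi q * form h q x y.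
Proof. by rewrite /form /conformal -scalemxAr -scalemxAl mxE. Qed.

(** The Koszul expression of [phi h] contains, besides [phi] times that of [h],
    the terms in which [phi] is differentiated. *)
Definition koszul_shift u v z q : R :=
  2^-1 * ('D_u phi q * form h q v z + 'D_v phi q * form h q u z
          - 'D_z phi q * form h q u v).

Lemma near_koszul_conformal u v z : \forall q \near p,
  koszul conformal u v z q = phi q * koszul h u v z q + koszul_shift u v z q.
Proof.
apply: filterS2 (near_differentiable_unit h2 h_unit) (proj1 phi2).
move=> q [qd _] phiq.
have E w x y : 'D_w (fun q => form conformal q x y) q =
    phi q * 'D_w (fun q => form h q x y) q + form h q x y * 'D_w phi q.
  under eq_fun do rewrite form_conformal.
  by rewrite derive_mul //; exact: differentiable_form.
rewrite /koszul /koszul_shift !E.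
move: ('D_u (fun q => _) q) ('D_v (fun q => _) q) ('D_z (fun q => _) q).
move: ('D_u phi q) ('D_v phi q) ('D_z phi q) => a b c A B C; ring.
Qed.

Lemma koszul_conformal u v z :
  koszul conformal u v z p = phi p * koszul h u v z p + koszul_shift u v z p.
Proof. exact: nbhs_singleton (near_koszul_conformal u v z). Qed.

(** The vector on the right has the products with all [z] that the Koszul
    formula for [phi h] requires, and [h p] is nondegenerate. *)
Lemma connection_conformal u v :
  connection conformal u v p = connection h u v p +
    (2 * phi p)^-1 *: ('D_u phi p *: v + 'D_v phi p *: u
                       - form h p u v *: gradient).
Proof.
apply: form_inj => z; apply: (mulfI phi_neq0).
rewrite -form_conformal form_connection; last first.
- exact: conformal_unit.
- by move=> i j; exact: twice_differentiableW (conformal_twice_differentiable i j).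
- exact: conformal_sym.
rewrite koszul_conformal formDl form_connection // formZl !formDl formNl !formZl.
by rewrite form_gradient /koszul_shift; field.
Qed.

Lemma derive_koszul_shift x u v z :
  'D_x (koszul_shift u v z) p = 2^-1 *
    ('D_x ('D_u phi) p * form h p v z
       + 'D_u phi p * (koszul h x v z p + koszul h x z v p)
     + ('D_x ('D_v phi) p * form h p u z
       + 'D_v phi p * (koszul h x u z p + koszul h x z u p))
     - ('D_x ('D_z phi) p * form h p u v
       + 'D_z phi p * (koszul h x u v p + koszul h x v u p))).
Proof.
have fd := differentiable_form hd.
have E a b c : 'D_x (fun q => 'D_a phi q * form h q b c) p =
    'D_x ('D_a phi) p * form h p b c
       + 'D_a phi p * (koszul h x b c p + koszul h x c b p).
  by rewrite derive_mul // derive_form_koszul // addrC mulrC.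
have D a b c : differentiable (fun q => 'D_a phi q * form h q b c) p.
  exact: differentiableM.
rewrite -!E derive_mulc; last first.
  by apply: differentiableB => //; exact: differentiableD.
rewrite deriveB; last 2 first.
- by apply: diff_derivable; exact: differentiableD.
- exact: diff_derivable.
by rewrite deriveD //; exact: diff_derivable.
Qed.

Lemma differentiable_koszul_shift u v z : differentiable (koszul_shift u v z) p.
Proof.
have fd := differentiable_form hd.
have D a b c : differentiable (fun q => 'D_a phi q * form h q b c) p.
  exact: differentiableM.
apply: differentiable_mulc.
by apply: differentiableB => //; exact: differentiableD.
Qed.

Lemma derive_koszul_conformal x u v z :
  'D_x (koszul conformal u v z) p =
    phi p * 'D_x (koszul h u v z) p + koszul h u v z p * 'D_x phi p
    + 'D_x (koszul_shift u v z) p.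
Proof.
rewrite (near_eq_derive _ (near_koszul_conformal u v z)).
have kd := differentiable_koszul h2 u v z.
have sd := differentiable_koszul_shift u v z.
have ksd := differentiableM phid kd.
rewrite -(derive_mul x phid kd) -deriveD //; exact: diff_derivable.
Qed.

Lemma connectionC u v : connection h u v p = connection h v u p.
Proof. by apply: form_inj => z; rewrite !form_connection // koszulC. Qed.

(** Both curvatures are expanded by [form_curvature]. What remains is an
    identity between numbers once the products with the three connection fields
    are replaced by Koszul expressions; [schwarz] identifies the two mixed
    second derivatives of [phi]. *)
Lemma curvature_conformal u v :
  form conformal p (curvature_of conformal u v v p) u =
    phi p * form h p (curvature_of h u v v p) u
    - 2^-1 * (covariant_hessian u u * form h p v v
              + covariant_hessian v v * form h p u u
              - 2 * covariant_hessian u v * form h p u v)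
    + 3 / (4 * phi p) * ('D_u phi p ^+ 2 * form h p v v
                         + 'D_v phi p ^+ 2 * form h p u u
                         - 2 * 'D_u phi p * 'D_v phi p * form h p u v)
    - (4 * phi p)^-1 * form h p gradient gradient
      * (form h p u u * form h p v v - form h p u v ^+ 2).
Proof.
rewrite (form_curvature conformal_sym conformal_twice_differentiable
  conformal_unit) (form_curvature h_sym h2 h_unit).
rewrite (derive_koszul_conformal u v v u) (derive_koszul_conformal v u v u).
rewrite (derive_koszul_shift u v v u) (derive_koszul_shift v u v u).
rewrite (form_conformal p (connection _ v v p)).
rewrite (form_conformal p (connection _ u v p)).
rewrite (connection_conformal v v) (connection_conformal u u).
rewrite (connection_conformal u v) (connection_conformal v u).
rewrite /covariant_hessian (connectionC v u) (schwarz v u phi2).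
rewrite (koszulC h_sym v u) (koszulC h_sym v u) (formC h_sym p v u).
have fC x a z : form h p (connection h x a p) z = koszul h x a z p.
  exact: form_connection.
have G_l z : form h p gradient z = 'D_z phi p := form_gradient z.
have G_r z : form h p z gradient = 'D_z phi p by rewrite formC // form_gradient.
have sym := formC h_sym p.
(* Apart from these four products, the connection fields only enter through
   terms that are common to both sides, so they can be arbitrary vectors. *)
have Cuu := fC u u v; have Cvv := fC v v u.
have Cuv := fC u v u; have Cuv' := fC u v v.
move: Cuu Cvv Cuv Cuv'; clear fC.
move: (connection h u u p) (connection h v v p) (connection h u v p) => U V W.
move=> UE VE WuE WvE.
rewrite !(formDl, formDr, formNl, formNr, formZl, formZr) !G_r.
rewrite (sym u W) (sym v W) (sym v U) (sym v u) (sym gradient) !G_l !G_r.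
rewrite ?G_l ?G_r UE VE WuE WvE.
move: ('D_u (koszul h v v u) p) ('D_v (koszul h u v u) p).
move: (koszul h v v u p) (koszul h u v u p) (koszul h u u v p) (koszul h u v v p).
move: ('D_u ('D_u phi) p) ('D_u ('D_v phi) p) ('D_v ('D_v phi) p).
move: ('D_U phi p) ('D_V phi p) ('D_W phi p) ('D_u phi p) ('D_v phi p).
move: ('D_gradient phi p) (form h p V U) (form h p W W).
move: (form h p u u) (form h p u v) (form h p v v) (phi p) phi_neq0.
clear => *.
by field.
Qed.

End Conformal.

(** * The conformal factor [1/f + r] *)

Section FunctionOfConformalFactor.
Context {R : realType} {n : nat}.
Variables (h : 'rV[R]_n -> 'M[R]_n) (f : 'rV[R]_n -> R) (p : 'rV[R]_n) (r : R).
Implicit Types (q u v w x y z : 'rV[R]_n).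
Hypothesis h_sym : forall q, (h q)^T = h q.
Hypothesis h2 : forall i j, twice_differentiable (fun q => h q i j) p.
Hypothesis h_unit : h p \in unitmx.
Hypothesis f2 : twice_differentiable f p.
Hypothesis f_neq0 : f p != 0.

Definition inverse_shift q : R := (f q)^-1 + r.

Let fd : differentiable f p := twice_differentiableW f2.

Lemma twice_differentiable_inverse_shift : twice_differentiable inverse_shift p.
Proof.
apply: twice_differentiableD; last exact: twice_differentiable_cst.
exact: twice_differentiableV.
Qed.

Lemma derive_inverse_shift q v : differentiable f q -> f q != 0 ->
  'D_v inverse_shift q = - (f q ^- 2 * 'D_v f q).
Proof.
move=> fqd fq0; rewrite /inverse_shift.
have vd := differentiableV fqd fq0.
rewrite deriveD; last 2 first.
- exact: diff_derivable.
- exact: derivable_cst.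
rewrite derive_cst addr0 deriveV //; last exact: diff_derivable.
by rewrite -mulNr.
Qed.

Lemma derive2_inverse_shift u v :
  'D_u ('D_v inverse_shift) p =
    - (f p ^- 2 * 'D_u ('D_v f) p) + 2 * f p ^- 3 * 'D_u f p * 'D_v f p.
Proof.
have near_f : \forall q \near p,
    'D_v inverse_shift q = - ((f q)^-1 * ((f q)^-1 * 'D_v f q)).
  have [f1 _] := f2; have fn0 := near_neq0 fd f_neq0.
  apply: filterS2 f1 fn0 => q fq fq0.
  by rewrite derive_inverse_shift // mulrA expr2 invfM.
rewrite (near_eq_derive _ near_f).
have vd := differentiableV fd f_neq0.
have dd : differentiable ('D_v f) p by have [_] := f2.
have vdd : differentiable (fun q => (f q)^-1 * 'D_v f q) p.
  exact: differentiableM.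
rewrite deriveN; last by apply: diff_derivable; exact: differentiableM.
rewrite (derive_mul u vd vdd) (derive_mul u vd dd).
rewrite deriveV //; last exact: diff_derivable.
rewrite -[_ *: _]/(- f p ^- 2 * 'D_u f p); by field.
Qed.

Lemma covariant_hessian_inverse_shift u v :
  covariant_hessian h inverse_shift p u v =
    - (f p ^- 2 * covariant_hessian h f p u v)
    + 2 * f p ^- 3 * 'D_u f p * 'D_v f p.
Proof.
rewrite /covariant_hessian derive2_inverse_shift derive_inverse_shift //; ring.
Qed.

Lemma gradient_inverse_shift :
  gradient h inverse_shift p = - f p ^- 2 *: gradient h f p.
Proof.
rewrite /gradient scalemxAl; congr (_ *m _); apply/rowP => i.
by rewrite !mxE /partial derive_inverse_shift // mulNr.
Qed.

Lemma covariant_hessian_partial u v :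
  covariant_hessian h f p u v = \sum_i \sum_j u 0 i * v 0 j *
    (partial i (partial j f) p
     - \sum_l christoffel_of h l i j p * partial l f p).
Proof.
have near_f : \forall q \near p, 'D_v f q = \sum_j v 0 j * partial j f q.
  by apply: filterS (proj1 f2) => q; exact: derive_partial.
have pd j : differentiable (partial j f) p by have [_ fp] := f2; exact: fp.
rewrite /covariant_hessian (near_eq_derive _ near_f).
rewrite derive_fun_sum => [|j]; last exact: differentiable_mulc.
have -> : \sum_j 'D_u (fun q => v 0 j * partial j f q) p =
    \sum_i \sum_j u 0 i * v 0 j * partial i (partial j f) p.
  rewrite exchange_big /=; apply: eq_bigr => j _.
  rewrite derive_mulc // derive_partial // mulr_sumr.
  by apply: eq_bigr => i _; rewrite mulrCA mulrA.
rewrite derive_partial //.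
have -> : \sum_l connection h u v p 0 l * partial l f p =
    \sum_i \sum_j u 0 i * v 0 j * \sum_l christoffel_of h l i j p * partial l f p.
  under eq_bigr do rewrite connectionE mulr_suml.
  rewrite exchange_big /=; apply: eq_bigr => i _.
  under eq_bigr do rewrite mulr_suml.
  rewrite exchange_big /=; apply: eq_bigr => j _.
  by rewrite mulr_sumr; apply: eq_bigr => l _; rewrite mulrA.
rewrite -sumrB; apply: eq_bigr => i _; rewrite -sumrB; apply: eq_bigr => j _.
by rewrite mulrBr.
Qed.

Lemma form_gradient_gradient :
  form h p (gradient h f p) (gradient h f p) =
  ((\row_i partial i f p) *m invmx (h p) *m (\row_i partial i f p)^T) 0 0.
Proof.
rewrite /form /gradient mulmxKV // trmx_mul trmx_inv h_sym -mulmxA.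
by rewrite mulmxA.
Qed.

End FunctionOfConformalFactor.

(** * Inequalities for the plane traces *)

(** Read [E], [F], [G] as the Gram matrix of a basis [u, v]. The first
    inequality is a bound for the vector [u], the second one for the component
    [v - (F / E) u] of [v] orthogonal to [u], whose squared norm is
    [(E G - F^2) / E]. Weighted with [(E G - F^2) / E] and [E] they add up to
    the traces over the plane, multiplied by [E G - F^2]. *)
Lemma plane_trace_lt (R : realFieldType) (E F G Huu Huv Hvv fu fv A C : R) :
  0 < E -> 0 < E * G - F ^+ 2 -> Huu < A * fu ^+ 2 + C * E ->
  Hvv - 2 * (F / E) * Huv + (F / E) ^+ 2 * Huu <
    A * (fv - F / E * fu) ^+ 2 + C * ((E * G - F ^+ 2) / E) ->
  Huu * G + Hvv * E - 2 * Huv * F <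
    A * (fu ^+ 2 * G + fv ^+ 2 * E - 2 * fu * fv * F)
    + 2 * C * (E * G - F ^+ 2).
Proof.
move=> E0 D0; have DE0 : 0 < (E * G - F ^+ 2) / E by rewrite divr_gt0.
rewrite -(ltr_pM2l DE0) => lt1; rewrite -(ltr_pM2l E0) => lt2.
have := ltrD lt1 lt2; congr (_ < _); field; exact: lt0r_neq0.
Qed.

(** The bound on [TH] divided by [2 a ^+ 2] is the conclusion: the terms in
    [N], [Tf] and [S] agree. Here [a] is the value of [k], [D = E G - F^2], [S]
    is the squared norm of [dk], and [TH], [Tf] are [D] times the traces of the
    Hessian of [k] and of the square of [dk]. *)
Lemma conformal_curvature_lt0 (R : realFieldType) (a r D N TH Tf S : R) :
  0 < a -> 0 < 1 + r * a -> 0 < D ->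
  TH < (1 + 4 * r * a) / (2 * a * (1 + r * a)) * Tf
     + 2 * (1 / (4 * a * (1 + r * a)) * S - a * (1 + r * a) * (N / D)) * D ->
  (a^-1 + r) * N - 2^-1 * (- (a ^- 2 * TH) + 2 * a ^- 3 * Tf)
    + 3 / (4 * (a^-1 + r)) * (a ^- 4 * Tf)
    - (4 * (a^-1 + r))^-1 * (a ^- 4 * S) * D < 0.
Proof.
move=> a0 ra0 D0.
have c0 : 0 < (2 * a ^+ 2)^-1 by rewrite invr_gt0 mulr_gt0 // exprn_gt0.
rewrite -(ltr_pM2l c0) -subr_lt0; congr (_ < 0).
have -> : a^-1 + r = (1 + r * a) / a by field; exact: lt0r_neq0.
field; rewrite !lt0r_neq0 //.
Qed.

(** * The metric in the chart at a point *)

Section Charts.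
Context {R : realType} {n : nat} {M : smooth_manifold R n}.
Implicit Types (g : form_field M) (k : M -> R) (x : M).

Lemma param_chart_at x : param (chart_at x) (chart_at x x) = x.
Proof. by apply: coordK; rewrite inE; exact: chart_at_dom. Qed.

Lemma image_chart_at x : (chart_at x @` dom (chart_at x)) (chart_at x x).
Proof. by exists x => //; exact: chart_at_dom. Qed.

(** Near the given point the transition map from the chart to itself is the
    identity, so the Jacobian in the definition is the identity matrix. *)
Lemma local_form_chart_at g x : local_form g (chart_at x) (chart_at x x) = g x.
Proof.
rewrite /local_form param_chart_at.
set c := chart_at x; set J := jacobian _ _.
suff -> : J = 1%:M by rewrite mul1mx trmx1 mulmx1.
have idc : \forall q \near c x, id q = c (param c q).
  have : \forall q \near c x, (c @` dom c) q.
    by apply: open_nbhs_nbhs; split; [exact: image_open|exact: image_chart_at].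
  by apply: filterS => _ [z zc <-] /=; rewrite coordK // inE.
have [_ dE] := near_eq_diff idc (@ex_diff _ _ _ _ _ _ _ (is_diff_id (c x))).
by apply/matrixP => i j; rewrite !mxE dE diff_val mxE eqxx /= eq_sym.
Qed.

Lemma local_form_sym g (c : chart R n M) q :
  (forall x u v, form_at g x u v = form_at g x v u) ->
  (local_form g c q)^T = local_form g c q.
Proof.
move=> g_sym; have gT x : (g x)^T = g x.
  apply/matrixP => i j; rewrite mxE; have := g_sym x (delta_mx 0 j) (delta_mx 0 i).
  by rewrite /form_at !trmx_delta -!rowE -!colE !mxE.
by rewrite /local_form !trmx_mul trmxK gT mulmxA.
Qed.

Lemma positive_unitmx (A : 'M[R]_n) :
  (forall v : 'rV[R]_n, v != 0 -> 0 < (v *m A *m v^T) 0 0) -> A \in unitmx.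
Proof.
move=> A_pos; rewrite -row_free_unit -kermx_eq0; apply/rowV0P => v /sub_kermxP vA.
by apply: contraTeq isT => /A_pos; rewrite vA mul0mx mxE ltxx.
Qed.

Lemma local_form_rescaled g k r (c : chart R n M) :
  local_form (rescaled_metric g k r) c =
  conformal (local_form g c) (inverse_shift (k \o param c) r).
Proof.
apply/funext => q.
by rewrite /local_form /rescaled_metric /conformal -scalemxAr -scalemxAl.
Qed.

Lemma gt0_of_inf_gt0 k x : 0 < inf (range k) -> 0 < k x.
Proof.
move=> k_inf; apply: (lt_le_trans k_inf); apply: ge_inf; last by exists x.
case: (pselect (has_inf (range k))) => [[]//|/inf_out k0].
by rewrite k0 ltxx in k_inf.
Qed.

(** If [k] is bounded and [r < 0], then [r k >= r sup k > -1]. *)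
Lemma one_plus_rk_gt0 k r x : 0 < inf (range k) -> lower_bound_r k < r ->
  0 < 1 + r * k x.
Proof.
move=> /gt0_of_inf_gt0 k_gt0; rewrite /lower_bound_r.
case: asboolP => [k_ub|_] r_gt; last first.
  by rewrite ltr_wpDl // mulr_gt0.
have kx_le : k x <= sup (range k) by apply: ub_le_sup => //; exists x.
have K0 : 0 < sup (range k) := lt_le_trans (k_gt0 x) kx_le.
have [r0|r0] := leP 0 r; first by rewrite ltr_pwDl // mulr_ge0 // ltW.
apply: (@lt_le_trans _ _ (1 + r * sup (range k))).
  rewrite -ltrBlDl sub0r -(ltr_pdivrMr _ _ K0); by rewrite mulN1r.
by rewrite lerD2l ler_nM2l.
Qed.

End Charts.

(** * Negativity of the curvature *)

Lemma plane_basis (R : fieldType) (V : vectType R) (s : {vspace V}) :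
  (\dim s = 2)%N ->
  let u := (vbasis s)`_0 in let v := (vbasis s)`_1 in
  [/\ u \in s, v \in s, u != 0 & forall t, v - t *: u != 0].
Proof.
move=> s2 u v.
have sE : vbasis s = [:: u; v] :> seq V.
  have s_size : size (vbasis s) = 2%N by rewrite size_tuple.
  apply: (@eq_from_nth _ 0) => [|i]; rewrite s_size //.
  by case: i => [|[|]].
have s_free := basis_free (vbasisP s); rewrite sE in s_free.
have u0 : u != 0.
  exact: free_not0 s_free (mem_head _ _).
have v0 : v != 0.
  by move: s_free; rewrite free_cons seq1_free => /andP[].
split=> //.
- by apply: vbasis_mem; apply: mem_nth; rewrite size_tuple s2.
- by apply: vbasis_mem; apply: mem_nth; rewrite size_tuple s2.
move=> t; apply: contraTneq s_free => /eqP; rewrite subr_eq0 => /eqP vE.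
have t0 : t != 0 by apply: contraNneq v0 => t0; rewrite vE t0 scale0r.
rewrite free_cons span_seq1 negb_and negbK; apply/orP; left.
by apply/vlineP; exists t^-1; rewrite vE scalerA mulVf // scale1r.
Qed.

Theorem lemma5p1 (R : realType) (n : nat) (M : smooth_manifold R n)
    (g : form_field M) (k : M -> R)
    (M_connected : connected [set: M])
    (g_riemannian : riemannian_metric g)
    (g_complete : complete_metric g)
    (k_smooth : smooth_function k)
    (k_inf_gt0 : 0 < inf (range k))
    (n_gt1 : (1 < n)%N)
    (g_negative : negative_sectional_curvature g)
    (hess_lt : forall r : R, lower_bound_r k < r ->
      forall (x : M) (s : {vspace 'rV[R]_n}), (\dim s = 2)%N ->
      forall e : 'rV[R]_n, e \in s -> form_at g x e e = 1 ->
        hessian g k x e e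
        < (1 + 4 * r * k x) / (2 * k x * (1 + r * k x)) * differential k x e ^+ 2
          + 1 / (4 * k x * (1 + r * k x)) * sqnorm_differential g k x
          - k x * (1 + r * k x) * sectional_curvature g x s) :
  forall r : R, lower_bound_r k < r ->
    negative_sectional_curvature (rescaled_metric g k r).
Proof.
move=> r r_gt x s s2; have [g_sym g_pos g_smooth] := g_riemannian.
pose c := chart_at x; pose p := c x; pose h := local_form g c.
pose f := k \o param c; pose phi := inverse_shift f r.
have hp : h p = g x := local_form_chart_at g x.
have h_sym q : (h q)^T = h q by exact: local_form_sym.
have h2 i j : twice_differentiable (fun q => h q i j) p.
  apply: smooth_twice_differentiable (image_chart_at x); first exact: image_open.
  exact: g_smooth (chart_at_atlas x) i j.
have h_unit : h p \in unitmx by rewrite hp; apply: positive_unitmx; exact: g_pos.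
have f2 : twice_differentiable f p.
  apply: smooth_twice_differentiable (image_chart_at x); first exact: image_open.
  exact: k_smooth (chart_at_atlas x).
have fp : f p = k x by rewrite /f /= param_chart_at.
have k0 : 0 < k x by exact: gt0_of_inf_gt0.
have kr0 : 0 < 1 + r * k x by exact: one_plus_rk_gt0.
have f0 : f p != 0 by rewrite fp lt0r_neq0.
have phip : phi p = (k x)^-1 + r by rewrite /phi /inverse_shift fp.
have phi0 : 0 < phi p.
  rewrite phip -(pmulr_rgt0 _ k0) mulrDr mulfV ?lt0r_neq0 //.
  by rewrite [k x * r]mulrC.
have phi2 := twice_differentiable_inverse_shift r f2 f0.
have form_g y z : form_at g x y z = form h p y z by rewrite /form hp.
pose H := covariant_hessian h f p.
have HE y z : hessian g k x y z = H y z.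
  by rewrite /H covariant_hessian_partial.
have sqE : sqnorm_differential g k x = form h p (gradient h f p) (gradient h f p).
  by rewrite form_gradient_gradient // hp.
have [u_s v_s u0 uv0] := plane_basis s2.
rewrite /sectional_curvature.
set u := (vbasis s)`_0 in u_s u0 uv0 *; set v := (vbasis s)`_1 in v_s uv0 *.
pose E := form h p u u; pose F := form h p u v; pose G := form h p v v.
have form_pos y : y != 0 -> 0 < form h p y y by rewrite -form_g; exact: g_pos.
have E0 : 0 < E by exact: form_pos.
(* Gram-Schmidt; the vectors are normalized only when the hypothesis is used. *)
pose w := v - (F / E) *: u.
have wE : form h p w w = (E * G - F ^+ 2) / E.
  rewrite /w -scaleNr !(formDl, formDr, formZl, formZr) (formC h_sym p v u).
  by rewrite -/E -/F -/G; field; exact: lt0r_neq0.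
have D0 : 0 < E * G - F ^+ 2.
  have := form_pos w (uv0 _).
  by rewrite wE pmulr_lgt0 // invr_gt0.
pose N := form h p (curvature_of h u v v p) u.
have KE : sectional_curvature g x s = N / (E * G - F ^+ 2).
  by rewrite /sectional_curvature /sectional_curvature_of !form_g.
(* The Hessian as a bilinear form with constant matrix, for its bilinearity. *)
pose m := \matrix_(i, j) (partial i (partial j f) p
     - \sum_l christoffel_of h l i j p * partial l f p).
have Hm y z : H y z = form (fun=> m) p y z.
  rewrite formE /H covariant_hessian_partial //.
  by apply: eq_bigr => i _; apply: eq_bigr => j _; rewrite [m i j]mxE.
have H_sym y z : H y z = H z y.
  rewrite /H /covariant_hessian (schwarz y z f2).
  by rewrite (connectionC h_sym h2 h_unit y z).
have fd : differentiable f p := twice_differentiableW f2.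
pose A := (1 + 4 * r * k x) / (2 * k x * (1 + r * k x)).
pose S := form h p (gradient h f p) (gradient h f p).
pose C := 1 / (4 * k x * (1 + r * k x)) * S
  - k x * (1 + r * k x) * (N / (E * G - F ^+ 2)).
have H_lt y : y \in s -> y != 0 ->
    H y y < A * 'D_y f p ^+ 2 + C * form h p y y.
  move=> ys /form_pos; set Q := form h p y y => Q0.
  pose t := (Num.sqrt Q)^-1.
  have t2 : t ^+ 2 = Q^-1 by rewrite /t exprVn sqr_sqrtr // ltW.
  have := hess_lt r r_gt x s s2 (t *: y).
  rewrite memvZ // form_g formZl formZr mulrA -expr2 t2 mulVf ?lt0r_neq0 //.
  move=> /(_ isT erefl).
  rewrite HE Hm formZl formZr -Hm mulrA -expr2 t2.
  rewrite [differential _ _ _](deriveZv t y fd) exprMn t2 sqE -/S KE -/A -addrA -/C.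
  have Qi0 : 0 < Q^-1 by rewrite invr_gt0.
  move=> ineq; rewrite -(ltr_pM2l Qi0) [ltRHS]mulrDr [Q^-1 * (C * Q)]mulrC.
  by rewrite mulfK ?lt0r_neq0 // [Q^-1 * (A * _)]mulrCA.
have Hu := H_lt u u_s u0.
have := H_lt w (memvB v_s (memvZ _ u_s)) (uv0 _).
rewrite wE /w -scaleNr (deriveDv _ _ fd) (deriveZv _ _ fd) mulNr.
rewrite !Hm !(formDl, formDr, formZl, formZr) -!Hm (H_sym v u) => Hw.
pose TH := H u u * G + H v v * E - 2 * H u v * F.
pose Tf := 'D_u f p ^+ 2 * G + 'D_v f p ^+ 2 * E - 2 * 'D_u f p * 'D_v f p * F.
have TH_lt : TH < A * Tf + 2 * C * (E * G - F ^+ 2).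
  apply: (plane_trace_lt E0 D0 Hu); move: Hw; congr (_ < _).
  by move: (H u u) (H u v) (H v v) => Huu Huv Hvv; ring.
have form_r y z : form_at (rescaled_metric g k r) x y z = phi p * form h p y z.
  by rewrite /form_at /rescaled_metric -scalemxAr -scalemxAl mxE -/(form_at g x y z)
    form_g phip.
have curvE : curvature_vector (rescaled_metric g k r) x u v v =
    curvature_of (conformal h phi) u v v p.
  by rewrite -[conformal h phi](local_form_rescaled g k r c).
rewrite /sectional_curvature_of curvE !form_r -form_conformal.
rewrite -/E -/F -/G.
have den0 : 0 < phi p * E * (phi p * G) - (phi p * F) ^+ 2.
  rewrite (_ : _ - _ = phi p ^+ 2 * (E * G - F ^+ 2)); last by ring.
  by rewrite mulr_gt0 // exprn_gt0.
rewrite pmulr_llt0 ?invr_gt0 //.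
rewrite (curvature_conformal h_sym h2 h_unit phi2 (lt0r_neq0 phi0)).
rewrite -/E -/F -/G -/N !(covariant_hessian_inverse_shift h r f2 f0).
rewrite !(derive_inverse_shift r _ fd f0) (gradient_inverse_shift h r f2 f0).
rewrite formZl formZr -/S -!/(H _ _).
have := conformal_curvature_lt0 k0 kr0 D0 TH_lt.
rewrite -fp -[(f p)^-1 + r]/(phi p) -[inverse_shift f r p]/(phi p).
congr (_ < 0); rewrite /TH /Tf; move: (phi p) (lt0r_neq0 phi0).
move: (H u u) (H u v) (H v v) ('D_u f p) ('D_v f p) (f p) f0.
move: (E) (F) (G) (N) (S) => *.
by field; apply/andP.
Qed.
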